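(* Let $G$ be a finite group, let $I$ and $\Lambda$ be finite (non-empty) index sets, and let $P=(p_{\lambda i})$ be a regular $\Lambda\times I$ matrix with entries in $G^0$ that contains at least one zero entry. Let $\chi$ denote the chromatic number. (1) Suppose that $\mathcal{G}(\mathcal{M}_0[G;I,\Lambda;P])$ is connected. Let $z$ be the number of zeros in $P$. Then $\chi(\mathcal{G}(\mathcal{M}_0[G;I,\Lambda;P]))\leqslant z|G|$. (2) Suppose that $\mathcal{G}(\mathcal{M}_0[G;I,\Lambda;P])$ is not connected. Let $A_1,\ldots,A_n$ be all the $0$-closure submatrices of $P$ and let $z_1,\ldots,z_n$ be the number of zeros in $A_1,\ldots,A_n$, respectively. Then $\chi(\mathcal{G}(\mathcal{M}_0[G;I,\Lambda;P]))\leqslant\max\{2,z_1,\ldots,z_n\}\,|G|$.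
   Context: $G^0=G\cup\{0\}$ is $G$ with a zero adjoined. A matrix over $G^0$ is regular if every row and every column contains a non-zero entry. The $0$-Rees matrix semigroup $\mathcal{M}_0[G;I,\Lambda;P]$ is the set $(I\times G\times\Lambda)\cup\{0\}$ with $(i,x,\lambda)(j,y,\mu)=(i,xp_{\lambda j}y,\mu)$ if $p_{\lambda j}\neq 0$, $(i,x,\lambda)(j,y,\mu)=0$ if $p_{\lambda j}=0$, and all products involving $0$ equal to $0$. The commuting graph $\mathcal{G}(S)$ of a finite non-commutative semigroup $S$ is the simple graph with vertex set $S\setminus Z(S)$ ($Z(S)$ the center), where distinct $x,y$ are adjacent iff $xy=yx$. (When $P$ is regular and has a zero entry, $\mathcal{M}_0[G;I,\Lambda;P]$ is non-commutative with center $\{0\}$.) For $I'\subseteq I$, $\Lambda'\subseteq\Lambda$, $P[\Lambda'|I']$ is the submatrix of $P$ with rows indexed by $\Lambda'$ and columns by $I'$. $0$-closure method: let $p_{\lambda i}=0$. Put $I_0=\{i\}$, $\Lambda_0=\{\lambda\}$ and, for $k\ge 0$, $I_{k+1}=I_k\cup\{j\in I: p_{\mu j}=0\text{ for some }\mu\in\Lambda_k\}$ and $\Lambda_{k+1}=\Lambda_k\cup\{\mu\in\Lambda: p_{\mu j}=0\text{ for some }j\in I_k\}$. Let $\zeta(\lambda,i)$ be the least $k$ with $I_{k+1}=I_k$ and $\Lambda_{k+1}=\Lambda_k$. The $0$-closure $(\lambda,i)$-submatrix of $P$ is $P[\Lambda_k|I_k]$ with $k=\zeta(\lambda,i)$.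 A $0$-closure submatrix of $P$ is a $0$-closure $(\lambda,i)$-submatrix for some $(\lambda,i)$ with $p_{\lambda i}=0$; it is regarded as a submatrix together with its row and column index sets. *)

(* Defs.v *)
From HB Require Import structures.
From mathcomp Require Import all_boot all_fingroup.

Set Implicit Arguments.
Unset Strict Implicit.
Unset Printing Implicit Defensive.

Record sgraph := SGraph {
  svertex :> finType;
  sedge : rel svertex;
  sedge_sym : symmetric sedge;
  sedge_irr : irreflexive sedge
}.

Definition connected_graph (X : sgraph) : bool :=
  [forall x : X, forall y : X, connect (@sedge X) x y].

Definition proper_coloring (X : sgraph) (C : eqType) (c : X -> C) : bool :=
  [forall x : X, forall y : X, sedge x y ==> (c x != c y)].

Definition colorable (X : sgraph) (k : nat) : bool :=
  [exists c : {ffun X -> 'I_k}, proper_coloring c].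

Lemma colorable_card (X : sgraph) : exists k, colorable X k.
Proof.
exists #|X|; apply/existsP; exists [ffun x => enum_rank x].
apply/forallP=> x; apply/forallP=> y; apply/implyP=> exy; rewrite !ffunE.
by apply: contraL exy => /eqP/enum_rank_inj ->; rewrite sedge_irr.
Qed.

Definition chromatic_number (X : sgraph) : nat := ex_minn (colorable_card X).

(* A finite semigroup is given by an associative law on a finite type. *)

Section CommutingGraph.

Variables (S : finType) (mul : SemiGroup.law S).

Definition scenter : {set S} := [set x | [forall y : S, mul x y == mul y x]].

Definition noncentral : finType := {x : S | x \notin scenter}.

Definition commuting_rel : rel noncentral :=
  [rel x y | (x != y) && (mul (val x) (val y) == mul (val y) (val x))].

Lemma commuting_rel_sym : symmetric commuting_rel.
Proof. by move=> x y; congr (_ && _); rewrite eq_sym. Qed.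

Lemma commuting_rel_irr : irreflexive commuting_rel.
Proof. by move=> x; apply/negP; rewrite /commuting_rel /= eqxx. Qed.

Definition commuting_graph : sgraph :=
  SGraph commuting_rel_sym commuting_rel_irr.

End CommutingGraph.

(* A matrix over G^0 is a function P with values in [option G], where [None] is
   the adjoined zero; P l i is the entry in row l and column i. *)

Definition regular_mx (G : Type) (L I : finType) (P : L -> I -> option G) :=
  (forall l, exists i, P l i <> None) /\ (forall i, exists l, P l i <> None).

Definition submatrix (G : Type) (L I : finType) (P : L -> I -> option G)
    (L' : {set L}) (I' : {set I}) :
    {l : L | l \in L'} -> {i : I | i \in I'} -> option G :=
  fun l i => P (val l) (val i).

Arguments submatrix {G L I} P L' I'.

Definition nzeros (G : eqType) (L I : finType) (P : L -> I -> option G) : nat :=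
  #|[set li : L * I | P li.1 li.2 == None]|.

(* [None] is the zero of the semigroup. *)

Section ZeroRees.

Variables (G : finGroupType) (I L : finType) (P : L -> I -> option G).

Definition zero_rees : finType := option (I * G * L).

Definition zero_rees_mul (s t : zero_rees) : zero_rees :=
  match s, t with
  | Some (i, x, l), Some (j, y, m) =>
      if P l j is Some p then Some (i, x * p * y, m)%g else None
  | _, _ => None
  end.

Lemma zero_rees_mulA : associative zero_rees_mul.
Proof.
case=> [[[i x] l]|] [[[j y] m]|] [[[k z] n]|] //=; last by case: (P l j).
by case Ep: (P l j) => [p|]; case Eq: (P m k) => [q|] //=;
  rewrite ?Ep ?Eq ?mulgA.
Qed.

HB.instance Definition _ :=
  SemiGroup.isLaw.Build zero_rees zero_rees_mul zero_rees_mulA.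

End ZeroRees.

(* A submatrix is encoded by its row and column index sets. *)

Section ZeroClosure.

Variables (G : eqType) (L I : finType) (P : L -> I -> option G).

Definition zclosure_step (A : {set L} * {set I}) : {set L} * {set I} :=
  (A.1 :|: [set m | [exists j in A.2, P m j == None]],
   A.2 :|: [set j | [exists m in A.1, P m j == None]]).

Definition zclosure_seq (l : L) (i : I) (k : nat) : {set L} * {set I} :=
  iter k zclosure_step ([set l], [set i]).

Lemma zclosure_stable l i :
  exists k, zclosure_seq l i k.+1 == zclosure_seq l i k.
Proof.
set A := zclosure_seq l i.
suff /(_ (#|L| + #|I|).+1)[//|] :
    forall n, (exists k, A k.+1 == A k) \/ n <= #|(A n).1| + #|(A n).2|.
  by rewrite ltnNge leq_add ?max_card.
elim=> [|n [|IHn]]; [by right | by left | ].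
have [eqA | neqA] := boolP (A n.+1 == A n); first by left; exists n.
have sL : (A n).1 \subset (A n.+1).1 by apply: subsetUl.
have sI : (A n).2 \subset (A n.+1).2 by apply: subsetUl.
right; apply: leq_ltn_trans IHn _; rewrite ltnNge; apply: contra neqA => le.
have /andP[/eqP eL /eqP eI] :
    (#|(A n).1| == #|(A n.+1).1|) && (#|(A n).2| == #|(A n.+1).2|).
  move: le (subset_leq_card sL) (subset_leq_card sI).
  move=> le leL leI; rewrite !eqn_leq leL leI /=.
  rewrite -(leq_add2r #|(A n).2|) (leq_trans _ le) ?leq_add2l //=.
  by rewrite -(leq_add2l #|(A n).1|) (leq_trans _ le) ?leq_add2r.
rewrite eq_sym [A n]surjective_pairing [A n.+1]surjective_pairing xpair_eqE.
by rewrite !eqEcard sL sI eL eI !leqnn.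
Qed.

Definition zeta (l : L) (i : I) : nat := ex_minn (zclosure_stable l i).

Definition zclosure (l : L) (i : I) : {set L} * {set I} :=
  zclosure_seq l i (zeta l i).

Definition zclosure_submatrices : {set {set L} * {set I}} :=
  [set zclosure li.1 li.2 | li : L * I & P li.1 li.2 == None].

End ZeroClosure.

(* Main.v *)
Require Import Defs.
From mathcomp Require Import all_boot all_fingroup.

Set Implicit Arguments.
Unset Strict Implicit.
Unset Printing Implicit Defensive.

(** Distinct blocks [(i, l)] and [(j, m)] of [I * L] contain commuting elements
    only if [p_(l, j) = p_(m, i) = 0], so it suffices to colour the blocks
    properly and to use [G] as a second coordinate.  If row [l] contains a zero,
    the block [(i, l)] receives a zero of row [l], namely [(l, i)] itself whenever
    [p_(l, i) = 0]: two blocks of the same row commute only if both have a zero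
    entry.  When the graph is connected every row contains a zero.  In general,
    consider the connected components of the bipartite graph of zeros on the rows
    and columns: a block whose row and column lie in distinct components [C], [D]
    only commutes with blocks whose row is in [D] and whose column is in [C], so
    two colours are enough for all such blocks, and the remaining ones are coloured
    by the zeros of their component, which is contained in a 0-closure. *)

Lemma chromatic_number_le_card (X : sgraph) (C : finType) (c : X -> C) k :
  #|C| <= k -> (forall x y, sedge x y -> c x != c y) -> chromatic_number X <= k.
Proof.
move=> leCk cP; rewrite /chromatic_number; case: ex_minnP => n _; apply.
apply/existsP; exists [ffun x => widen_ord leCk (enum_rank (c x))].
apply/forallP => x; apply/forallP => y; apply/implyP => /cP.
rewrite !ffunE; apply: contraNN => /eqP /(congr1 val) /= eq_rank.
by apply/eqP/enum_rank_inj/val_inj.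
Qed.

Section ZeroReesGraph.

Variables (G : finGroupType) (I L : finType) (P : L -> I -> option G).

Local Notation graph := (commuting_graph (zero_rees_mul P)).

Lemma zero_rees_mul_comm i x l j y m :
    zero_rees_mul P (Some (i, x, l)) (Some (j, y, m)) =
    zero_rees_mul P (Some (j, y, m)) (Some (i, x, l)) ->
  (P l j = None /\ P m i = None) \/ (i = j /\ l = m).
Proof.
move=> /=; case: (P l j) => [p|]; case: (P m i) => [q|] //; last by left.
by case=> -> _ ->; right.
Qed.

Lemma zero_in_scenter : None \in scenter (zero_rees_mul P).
Proof. by rewrite inE; apply/forallP => -[[[? ?] ?]|]. Qed.

(** A vertex [(i, x, l)] gets the colour [(c l i, x)]: commuting vertices of equal colour share
    their block and [x], hence coincide. *)
Lemma chromatic_number_blocks N (c : L -> I -> nat) :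
    (forall l i, c l i < N) ->
    (forall l i m j, P l j = None -> P m i = None -> c l i = c m j ->
       (l, i) = (m, j)) ->
  chromatic_number graph <= N * #|G|.
Proof.
move=> c_lt c_sep.
pose d (u : graph) : option ('I_N * G) :=
  if val u is Some (i, x, l) then Some (Ordinal (c_lt l i), x) else None.
(* [None] is central, so [d] takes a proper value at every vertex. *)
have dS (u : graph) : {w : 'I_N * G | d u = Some w}.
  rewrite /d; case: u => -[[[i x] l]|] /= uZ; first by eexists.
  by rewrite zero_in_scenter in uZ.
apply: (@chromatic_number_le_card _ _ (fun u => sval (dS u))).
  by rewrite card_prod card_ord.
move=> u v /andP[neq_uv /eqP comm_uv]; apply: contraNneq neq_uv => eq_d.
have : d u = d v by rewrite (svalP (dS u)) (svalP (dS v)) eq_d.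
rewrite -val_eqE /d; case: (val u) (val v) comm_uv => [[[i x] l]|] [[[j y] m]|] //.
move=> /zero_rees_mul_comm comm_uv [eq_c ->].
case: comm_uv => [[Plj Pmi]|[-> ->] //].
by have [-> ->] := c_sep _ _ _ _ Plj Pmi eq_c.
Qed.

(** For any row [m], commuting with some [(j, x, m)] such that [P l j] is non-zero forces [l = m]. A
    central element would thus leave a single row, and column [i0] would vanish. *)
Lemma Some_noncentral i x l :
    regular_mx P -> (exists l i, P l i = None) ->
  Some (i, x, l) \notin scenter (zero_rees_mul P).
Proof.
move=> [rowP colP] [l0 [i0 Pl0i0]]; rewrite inE; apply/negP => /forallP central.
have eq_row m : l = m.
  have [j Plj] := rowP l.
  by have /eqP/zero_rees_mul_comm[[/Plj]|[]] := central (Some (j, x, m)).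
by have [l1] := colP i0; rewrite -(eq_row l1) (eq_row l0).
Qed.

(** If row [l] had no zero, the vertices with last index [l] would be closed under adjacency;
    connectedness then forces [l = l0], a row with a zero. *)
Lemma connected_row_zero :
    regular_mx P -> (exists l i, P l i = None) -> connected_graph graph ->
  forall l, exists i, P l i == None.
Proof.
move=> Preg Pzero conn l; apply/existsP; apply: contraT => /existsPn rowN.
have [[i _] [l0 [i0 Pl0i0]]] := (Preg.1 l, Pzero).
pose elt j m : graph := exist (fun s => s \notin scenter (zero_rees_mul P))
  (Some (j, 1%g, m)) (Some_noncentral j 1%g m Preg Pzero).
pose row : pred graph := [pred w | if val w is Some (_, _, m) then m == l else false].
have row_step w w' : sedge w w' -> w \in row -> w' \in row.
  move=> /andP[_ /eqP]; rewrite !inE.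
  case: w w' => [[[[j x] m]|] /= wZ] [[[[k y] n]|] /= w'Z] //.
    move=> /zero_rees_mul_comm[[Pmk _] /eqP eq_ml|[_ <-] //].
    by have := rowN k; rewrite -eq_ml Pmk.
  by move: w'Z; rewrite zero_in_scenter.
have row_closed : closed (@sedge graph) row.
  move=> w w' ww'; apply/idP/idP; first exact: row_step.
  by apply: row_step; rewrite sedge_sym.
have := closed_connect row_closed (forallP (forallP conn (elt i l)) (elt i0 l0)).
rewrite !inE /= eqxx => /esym/eqP eq_l.
by have := rowN i0; rewrite -eq_l Pl0i0.
Qed.

End ZeroReesGraph.

Section Zeros.

Variables (G : eqType) (L I : finType) (P : L -> I -> option G).

(** The default [i] is reached only if row [l] has no zero. *)
Definition row_zero l i :=
  if P l i == None then i else odflt i [pick j | P l j == None].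

Lemma row_zeroP l i : (exists j, P l j == None) -> P l (row_zero l i) == None.
Proof.
rewrite /row_zero => -[j Plj]; case: ifP => // _.
by case: pickP => //= /(_ j); rewrite Plj.
Qed.

(** Equal colours give [l = m], so both zeros lie in one row and [row_zero] returns [i] and [j]
    themselves. *)
Lemma row_zero_sep l i m j :
    P l j = None -> P m i = None -> (l, row_zero l i) = (m, row_zero m j) ->
  (l, i) = (m, j).
Proof.
by move=> Plj Pmi [eq_lm]; rewrite /row_zero -eq_lm in Pmi *; rewrite Plj Pmi /= => ->.
Qed.

Lemma index_row_zero_sep (Z : {set L * I}) l i m j :
    P l j = None -> P m i = None -> (l, row_zero l i) \in Z ->
    index (l, row_zero l i) (enum Z) = index (m, row_zero m j) (enum Z) ->
  (l, i) = (m, j).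
Proof.
move=> Plj Pmi inZ eq_index; apply: row_zero_sep => //.
have inZ' : (m, row_zero m j) \in enum Z.
  by rewrite -index_mem -eq_index index_mem mem_enum.
by apply: (index_inj (l, i) _ inZ' eq_index); rewrite mem_enum.
Qed.

Lemma nzeros_submatrix (A : {set L} * {set I}) :
  nzeros (submatrix P A.1 A.2) =
    #|[set li | [&& li.1 \in A.1, li.2 \in A.2 & P li.1 li.2 == None]]|.
Proof.
pose f (li : {l | l \in A.1} * {i | i \in A.2}) := (val li.1, val li.2).
have f_inj : injective f.
  by case=> [l i] [m j] [/val_inj /= -> /val_inj /= ->].
rewrite /nzeros -(card_imset _ f_inj); apply: eq_card => -[l i].
rewrite !inE /=; apply/imsetP/and3P.
  by case=> -[[m mA] [j jA]]; rewrite inE /= => Pmj [-> ->].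
move=> [lA iA Pli].
by exists (exist _ l lA, exist _ i iA); rewrite ?inE.
Qed.

Lemma zclosure_fixpoint l i : zclosure_step P (zclosure P l i) = zclosure P l i.
Proof. by rewrite /zclosure /zeta; case: ex_minnP => k /eqP. Qed.

Lemma zclosure_row l i : l \in (zclosure P l i).1.
Proof.
rewrite /zclosure; elim: (zeta P l i) => [|k IHk]; first exact: set11.
by rewrite /zclosure_seq iterS inE IHk.
Qed.

Definition zero_edge : rel (L + I) := fun u v =>
  match u, v with
  | inl l, inr i | inr i, inl l => P l i == None
  | _, _ => false
  end.

Lemma zero_connect_sym : connect_sym zero_edge.
Proof. by apply: sym_connect_sym => -[l|i] [m|j]. Qed.

Local Notation comp := (root zero_edge).

Lemma comp_zero l i : P l i = None -> comp (inl l) = comp (inr i).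
Proof.
move=> Pli; apply/eqP; rewrite root_connect; last exact: zero_connect_sym.
by apply: connect1; rewrite /= Pli.
Qed.

(** A path from a row to a column is non-empty, and its first edge is a zero of row [l]. *)
Lemma comp_eq_row_zero l i :
  comp (inl l) = comp (inr i) -> exists j, P l j == None.
Proof.
move/eqP; rewrite root_connect; last exact: zero_connect_sym.
by case/connectP => -[|[m|j] p] //= /andP[Plj _] _; exists j.
Qed.

(** The 0-closure is fixed by [zclosure_step], hence closed under [zero_edge]; containing [l], it
    contains its component. *)
Lemma comp_zclosure l i m : comp (inl m) = comp (inl l) -> m \in (zclosure P l i).1.
Proof.
move/eqP; rewrite root_connect; last exact: zero_connect_sym.
pose inA : pred (L + I) := [pred u | match u with
  inl m => m \in (zclosure P l i).1 | inr j => j \in (zclosure P l i).2 end].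
have inA_step u v : zero_edge u v -> u \in inA -> v \in inA.
  rewrite !inE; case: u v => [m'|j'] [m''|j''] //= Pmj uA;
    rewrite -zclosure_fixpoint inE [X in _ || X]inE; apply/orP; right;
    apply/existsP; [exists m' | exists j']; exact/andP.
have inA_closed : closed zero_edge inA.
  move=> u v uv; apply/idP/idP; apply: inA_step => //.
  by case: u v uv => [?|?] [?|?].
by move/(closed_connect inA_closed); rewrite !inE zclosure_row.
Qed.

Definition comp_zeros (r : L + I) : {set L * I} :=
  [set li | (P li.1 li.2 == None) && (comp (inl li.1) == r)].

Lemma card_comp_zeros l i : P l i == None ->
  #|comp_zeros (comp (inl l))| <=
    \max_(A in zclosure_submatrices P) nzeros (submatrix P A.1 A.2).
Proof.
move=> Pli; have inA : zclosure P l i \in zclosure_submatrices P.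
  by apply/imsetP; exists (l, i); rewrite ?inE.
apply: (@leq_trans (nzeros (submatrix P (zclosure P l i).1 (zclosure P l i).2)));
  last exact: (leq_bigmax_cond (F := fun A => nzeros (submatrix P A.1 A.2))).
rewrite nzeros_submatrix; apply/subset_leq_card/subsetP => -[m j].
rewrite !inE /= => /andP[Pmj /eqP/(comp_zclosure i) mA]; rewrite mA Pmj andbT /=.
(* Row [m] lies in the closure, so one more step reaches column [j]. *)
rewrite -zclosure_fixpoint !inE; apply/orP; right.
by apply/existsP; exists m; apply/andP.
Qed.

(** Values may coincide between different components: among the other blocks, a block inside one
    component commutes only with those inside the same component. *)
Definition block_color l i : nat :=
  if comp (inl l) == comp (inr i)
  then index (l, row_zero l i) (enum (comp_zeros (comp (inl l))))
  else enum_rank (comp (inl l)) < enum_rank (comp (inr i)).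

Lemma row_zero_comp l i : comp (inl l) = comp (inr i) ->
  (l, row_zero l i) \in comp_zeros (comp (inl l)).
Proof. by move/comp_eq_row_zero => zl; rewrite inE /= row_zeroP /=. Qed.

Lemma block_color_lt l i :
  block_color l i <
    maxn 2 (\max_(A in zclosure_submatrices P) nzeros (submatrix P A.1 A.2)).
Proof.
rewrite /block_color leq_max; case: eqP => [eq_li|_]; apply/orP; last first.
  by left; rewrite ltnS leq_b1.
right; have [j /card_comp_zeros] := comp_eq_row_zero eq_li.
by apply: leq_trans; rewrite cardE index_mem mem_enum row_zero_comp.
Qed.

Lemma block_color_sep l i m j :
    P l j = None -> P m i = None -> block_color l i = block_color m j ->
  (l, i) = (m, j).
Proof.
move=> Plj Pmi; have [lj mi] := (comp_zero Plj, comp_zero Pmi).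
rewrite /block_color; have [li|neq_li] := eqVneq (comp (inl l)) (comp (inr i)).
  rewrite mi -lj li eqxx -li; apply: index_row_zero_sep => //.
  exact: row_zero_comp.
(* The two blocks have their row and column components exchanged, so the comparisons are
   opposite. *)
rewrite mi -lj eq_sym (negPf neq_li).
case: ltngtP => // /val_inj/enum_rank_inj eq_li.
by rewrite eq_li eqxx in neq_li.
Qed.

End Zeros.

Theorem theorem7p2 (G : finGroupType) (I L : finType) (P : L -> I -> option G)
    (P_regular : regular_mx P) (P_zero : exists l i, P l i = None) :
  (connected_graph (commuting_graph (zero_rees_mul P)) ->
     chromatic_number (commuting_graph (zero_rees_mul P)) <= nzeros P * #|G|) /\
  (~ connected_graph (commuting_graph (zero_rees_mul P)) ->
     chromatic_number (commuting_graph (zero_rees_mul P)) <=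
       maxn 2 (\max_(A in zclosure_submatrices P)
                  nzeros (submatrix P A.1 A.2)) * #|G|).
Proof.
split=> [conn | _]; last first.
  exact: chromatic_number_blocks (@block_color_lt _ _ _ P) (@block_color_sep _ _ _ P).
have rowz := connected_row_zero P_regular P_zero conn.
pose Z := [set li | P li.1 li.2 == None].
have inZ l i : (l, row_zero P l i) \in Z by rewrite inE row_zeroP.
(* The colour is the position in [enum Z] of the zero given to the block, hence below [nzeros P]. *)
apply: (@chromatic_number_blocks _ _ _ P _
         (fun l i => index (l, row_zero P l i) (enum Z))) => [l i|l i m j Plj Pmi].
  by rewrite /nzeros cardE index_mem mem_enum.
exact: index_row_zero_sep.
Qed.
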